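(* The Cesàro operator $\mathsf{C}\colon C_l([0,\infty])\to C_l([0,\infty])$ is power bounded, not hypercyclic and not mean ergodic. Moreover, $$\overline{(I-\mathsf{C})(C_l([0,\infty]))}=\{f\in C_l([0,\infty])\colon f(0)=f(\infty)=0\}.$$
   Context: $C_l([0,\infty])$ is the Banach space of all $\mathbb{C}$-valued continuous functions $f$ on $[0,\infty)$ for which $f(\infty):=\lim_{x\to\infty}f(x)$ exists in $\mathbb{C}$, equipped with the sup-norm. The continuous Cesàro operator is $\mathsf{C}f(x):=\frac1x\int_0^x f(t)\,dt$ for $x\in(0,\infty)$, with $\mathsf{C}f(0):=f(0)$; it maps $C_l([0,\infty])$ into itself. $I$ is the identity operator. For a bounded linear operator $T$ on a Banach space $X$ set $T_{[n]}:=\frac1n\sum_{m=1}^n T^m$, $n\in\mathbb{N}$. $T$ is power bounded if $\sup_{n\in\mathbb{N}}\|T^n\|_{op}<\infty$; mean ergodic if $(T_{[n]})_{n}$ converges in the strong operator topology to a bounded linear operator on $X$. For $X$ separable, $T$ is hypercyclic if there is $x\in X$ whose orbit $\{T^nx\colon n\in\mathbb{N}_0\}$ is dense in $X$. *)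

(* Defs.v *)
From Stdlib Require Import Reals Lra.
From Stdlib Require Import FunctionalExtensionality PropExtensionality ProofIrrelevance ClassicalEpsilon.
From Coquelicot Require Import Coquelicot.

Open Scope R_scope.

Lemma filterlim_C_eps {T : Type} {F : (T -> Prop) -> Prop} {FF : Filter F}
    (f : T -> C) (l : C) :
  filterlim f F (locally l) <->
  (forall eps : R, 0 < eps -> F (fun x => Cmod (Cminus (f x) l) < eps)).
Proof.
  rewrite (filterlim_locally_ball_norm (U := C_NormedModule) f l).
  split.
  - intros H eps Heps. exact (H (mkposreal eps Heps)).
  - intros H eps. exact (H eps (cond_pos eps)).
Qed.

Lemma Cmod_C_R_norm (z : C) : norm (V := C_R_NormedModule) z = Cmod z.
Proof.
  unfold norm; simpl; unfold prod_norm, Cmod; f_equal.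
  unfold norm; simpl; unfold abs; simpl.
  generalize (Rsqr_abs (fst z)) (Rsqr_abs (snd z)); unfold Rsqr; intros H1 H2.
  rewrite !Rmult_1_r, <- H1, <- H2; reflexivity.
Qed.

(* An element is represented by a function on [R] whose values on the negative
   half-line are fixed by convention to be the value at [0], so that equality
   of elements is equality on [[0,oo)]. *)
Record Cl : Type := mkCl {
  Cl_fun :> R -> C;
  Cl_neg : forall x : R, x < 0 -> Cl_fun x = Cl_fun 0;
  Cl_cont : continuous_on (fun x => 0 <= x) Cl_fun;
  Cl_lim : exists l : C, filterlim Cl_fun (Rbar_locally p_infty) (locally l)
}.

Definition at_infty (f : Cl) : C :=
  lim (T := C_CompleteNormedModule) (filtermap f (Rbar_locally p_infty)).

Lemma Cl_ext (f g : Cl) : (forall x, 0 <= x -> f x = g x) -> f = g.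
Proof.
  intros H.
  assert (E : Cl_fun f = Cl_fun g).
  { apply functional_extensionality; intros x.
    destruct (Rlt_dec x 0) as [Hx | Hx].
    - rewrite (Cl_neg f x Hx), (Cl_neg g x Hx). apply H; lra.
    - apply H; lra. }
  destruct f as [f f1 f2 f3], g as [g g1 g2 g3]; simpl in E; subst g.
  f_equal; apply proof_irrelevance.
Qed.

Lemma at_infty_correct (f : Cl) :
  filterlim f (Rbar_locally p_infty) (locally (at_infty f)).
Proof.
  destruct (Cl_lim f) as [l Hl].
  apply (filterlim_locally (U := C_UniformSpace)).
  unfold at_infty.
  apply (complete_cauchy (T := C_CompleteNormedModule)
           (filtermap f (Rbar_locally p_infty))).
  - apply filtermap_proper_filter, Rbar_locally_filter.
  - intros eps. exists l.
    exact (proj1 (filterlim_locally (U := C_UniformSpace) _ _) Hl eps).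
Qed.

Lemma at_infty_unique (f : Cl) (l : C) :
  filterlim f (Rbar_locally p_infty) (locally l) -> at_infty f = l.
Proof.
  intros Hl.
  apply (filterlim_locally_unique (V := C_NormedModule) (F := Rbar_locally p_infty) f).
  - exact (at_infty_correct f).
  - exact Hl.
Qed.

Lemma continuous_of_half_line (f : R -> C) :
  (forall x, x < 0 -> f x = f 0) -> continuous_on (fun x => 0 <= x) f ->
  forall x : R, continuous f x.
Proof.
  intros Hn Hc x. apply filterlim_C_eps. intros eps Heps.
  destruct (Rlt_dec x 0) as [Hx | Hx].
  - assert (Hp : 0 < - x) by lra.
    exists (mkposreal _ Hp). intros y Hy.
    change (Rabs (y - x) < - x) in Hy. apply Rabs_def2 in Hy.
    rewrite (Hn x Hx), (Hn y) by lra.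
    replace (f 0 - f 0)%C with (RtoC 0) by ring.
    rewrite Cmod_0; exact Heps.
  - assert (Hx0 : 0 <= x) by lra.
    destruct (proj1 (filterlim_C_eps f (f x)) (Hc x Hx0) eps Heps) as [d Hd].
    exists d. intros y Hy.
    destruct (Rlt_dec y 0) as [Hy0 | Hy0].
    + rewrite (Hn y Hy0). apply Hd; [| lra].
      change (Rabs (y - x) < d) in Hy. change (Rabs (0 - x) < d).
      apply Rabs_def2 in Hy. apply Rabs_def1; lra.
    + apply Hd; [exact Hy | lra].
Qed.

Lemma Cl_continuous (f : Cl) (x : R) : continuous f x.
Proof. apply continuous_of_half_line; [apply Cl_neg | apply Cl_cont]. Qed.

Lemma continuous_on_of_continuous (f : R -> C) :
  (forall x, 0 <= x -> continuous f x) -> continuous_on (fun x => 0 <= x) f.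
Proof.
  intros H x Hx. apply filterlim_filter_le_1 with (2 := H x Hx).
  apply filter_le_within.
Qed.

Lemma Cl_bounded (f : Cl) : exists M : R, forall x, 0 <= x -> Cmod (f x) <= M.
Proof.
  destruct (Cl_lim f) as [l Hl].
  destruct (proj1 (filterlim_C_eps f l) Hl 1 Rlt_0_1) as [A HA].
  destruct (bounded_continuity (V := C_NormedModule) f 0 A) as [M HM].
  { intros x _. exact (Cl_continuous f x). }
  exists (Rmax M (Cmod l + 1)). intros x Hx.
  destruct (Rle_dec x A) as [HxA | HxA].
  - apply Rle_trans with M; [| apply Rmax_l].
    apply Rlt_le, (HM x); split; assumption.
  - apply Rle_trans with (Cmod l + 1); [| apply Rmax_r].
    specialize (HA x (Rnot_le_lt _ _ HxA)).
    replace (f x) with (l + (f x - l))%C by ring.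
    eapply Rle_trans; [apply Cmod_triangle | lra].
Qed.

Lemma pointwise_lin_neg (a b : C) (f g : Cl) (x : R) :
  x < 0 -> (a * f x + b * g x)%C = (a * f 0%R + b * g 0%R)%C.
Proof. intros Hx. now rewrite (Cl_neg f x Hx), (Cl_neg g x Hx). Qed.

Lemma filterlim_lin {T : Type} {F : (T -> Prop) -> Prop} {FF : Filter F}
    (a b : C) (f g : T -> C) (lf lg : C) :
  filterlim f F (locally lf) -> filterlim g F (locally lg) ->
  filterlim (fun x => a * f x + b * g x)%C F (locally (a * lf + b * lg)%C).
Proof.
  intros Hf Hg. apply filterlim_C_eps. intros eps Heps.
  set (K := Cmod a + Cmod b + 1).
  assert (HK : 0 < K) by (generalize (Cmod_ge_0 a) (Cmod_ge_0 b); unfold K; lra).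
  assert (He : 0 < eps / K) by (apply Rdiv_lt_0_compat; assumption).
  generalize (proj1 (filterlim_C_eps f lf) Hf _ He)
             (proj1 (filterlim_C_eps g lg) Hg _ He); intros H1 H2.
  generalize (filter_and _ _ H1 H2). apply filter_imp.
  intros x [Hx1 Hx2].
  replace (a * f x + b * g x - (a * lf + b * lg))%C
    with (a * (f x - lf) + b * (g x - lg))%C by ring.
  eapply Rle_lt_trans; [apply Cmod_triangle |].
  rewrite !Cmod_mult.
  apply Rle_lt_trans with (Cmod a * (eps / K) + Cmod b * (eps / K)).
  - apply Rplus_le_compat; apply Rmult_le_compat_l;
      try apply Cmod_ge_0; now apply Rlt_le.
  - replace eps with (K * (eps / K)) at 3 by (field; lra).
    unfold K at 3. lra.
Qed.

Lemma pointwise_lin_cont (a b : C) (f g : Cl) :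
  continuous_on (fun x => 0 <= x) (fun x => a * f x + b * g x)%C.
Proof.
  intros x Hx.
  apply filterlim_lin; [exact (Cl_cont f x Hx) | exact (Cl_cont g x Hx)].
Qed.

Lemma pointwise_lin_lim (a b : C) (f g : Cl) :
  exists l : C,
    filterlim (fun x => a * f x + b * g x)%C (Rbar_locally p_infty) (locally l).
Proof.
  destruct (Cl_lim f) as [lf Hf], (Cl_lim g) as [lg Hg].
  exists (a * lf + b * lg)%C. now apply filterlim_lin.
Qed.

Definition Cl_lin (a b : C) (f g : Cl) : Cl :=
  mkCl (fun x => a * f x + b * g x)%C (pointwise_lin_neg a b f g)
       (pointwise_lin_cont a b f g) (pointwise_lin_lim a b f g).

Definition Cl_const (c : C) : Cl.
Proof.
  refine (mkCl (fun _ => c) (fun _ _ => eq_refl) _ _).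
  - intros x _. apply filterlim_const.
  - exists c. apply filterlim_const.
Defined.

Definition Cl_plus (f g : Cl) : Cl := Cl_lin 1 1 f g.
Definition Cl_opp (f : Cl) : Cl := Cl_lin (-1) 0 f f.
Definition Cl_scal (a : C) (f : Cl) : Cl := Cl_lin a 0 f f.
Definition Cl_zero : Cl := Cl_const 0.

Lemma Cl_plus_val (f g : Cl) (x : R) : Cl_plus f g x = (f x + g x)%C.
Proof. simpl; ring. Qed.
Lemma Cl_opp_val (f : Cl) (x : R) : Cl_opp f x = (- f x)%C.
Proof. simpl; ring. Qed.
Lemma Cl_scal_val (a : C) (f : Cl) (x : R) : Cl_scal a f x = (a * f x)%C.
Proof. simpl; ring. Qed.

Ltac Cl_solve :=
  intros; apply Cl_ext; intros; simpl; try ring.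

Definition Cl_AbelianMonoid_mixin : AbelianMonoid.mixin_of Cl.
Proof. refine (AbelianMonoid.Mixin Cl Cl_plus Cl_zero _ _ _); Cl_solve. Defined.
Canonical Cl_AbelianMonoid := AbelianMonoid.Pack Cl Cl_AbelianMonoid_mixin Cl.

Definition Cl_AbelianGroup_mixin : AbelianGroup.mixin_of Cl_AbelianMonoid.
Proof. refine (AbelianGroup.Mixin Cl_AbelianMonoid Cl_opp _); Cl_solve. Defined.
Canonical Cl_AbelianGroup :=
  AbelianGroup.Pack Cl (AbelianGroup.Class _ _ Cl_AbelianGroup_mixin) Cl.

Definition Cl_ModuleSpace_mixin : ModuleSpace.mixin_of C_Ring Cl_AbelianGroup.
Proof.
  refine (ModuleSpace.Mixin C_Ring Cl_AbelianGroup Cl_scal _ _ _ _); Cl_solve;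
    unfold mult, plus, one; simpl; ring.
Defined.
Canonical Cl_ModuleSpace :=
  ModuleSpace.Pack C_Ring Cl (ModuleSpace.Class C_Ring _ _ Cl_ModuleSpace_mixin) Cl.

Definition Cl_norm (f : Cl) : R :=
  real (Lub_Rbar (fun r => exists x : R, 0 <= x /\ r = Cmod (f x))).

Lemma Cl_norm_lub (f : Cl) :
  is_lub_Rbar (fun r => exists x : R, 0 <= x /\ r = Cmod (f x)) (Cl_norm f).
Proof.
  generalize (Lub_Rbar_correct (fun r => exists x : R, 0 <= x /\ r = Cmod (f x))).
  unfold Cl_norm.
  destruct (Cl_bounded f) as [M HM].
  destruct (Lub_Rbar _) as [l | |]; intros [H1 H2]; simpl.
  - now split.
  - exfalso. apply (H2 (Finite M)). intros r [x [Hx ->]]. apply (HM x Hx).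
  - exfalso. apply (H1 (Cmod (f 0))). exists 0; split; [lra | reflexivity].
Qed.

Lemma Cl_norm_ge (f : Cl) (x : R) : 0 <= x -> Cmod (f x) <= Cl_norm f.
Proof. intros Hx. apply (proj1 (Cl_norm_lub f)). now exists x. Qed.

Lemma Cl_norm_le (f : Cl) (M : R) :
  (forall x, 0 <= x -> Cmod (f x) <= M) -> Cl_norm f <= M.
Proof.
  intros H. apply (proj2 (Cl_norm_lub f) (Finite M)).
  intros r [x [Hx ->]]. now apply H.
Qed.

Lemma Cl_norm_ge_0 (f : Cl) : 0 <= Cl_norm f.
Proof. apply Rle_trans with (2 := Cl_norm_ge f 0 (Rle_refl 0)), Cmod_ge_0. Qed.

Lemma Cl_norm_zero : Cl_norm Cl_zero = 0.
Proof.
  apply Rle_antisym; [| apply Cl_norm_ge_0].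
  apply Cl_norm_le. intros x _. simpl. rewrite Cmod_0; lra.
Qed.

Lemma Cl_norm_plus (f g : Cl) : Cl_norm (plus f g) <= Cl_norm f + Cl_norm g.
Proof.
  apply Cl_norm_le; intros x Hx.
  change (Cmod (Cl_plus f g x) <= Cl_norm f + Cl_norm g). rewrite Cl_plus_val.
  eapply Rle_trans; [apply Cmod_triangle |].
  apply Rplus_le_compat; now apply Cl_norm_ge.
Qed.

Lemma Cl_norm_scal (a : C) (f : Cl) : Cl_norm (scal a f) <= Cmod a * Cl_norm f.
Proof.
  apply Cl_norm_le; intros x Hx.
  change (Cmod (Cl_scal a f x) <= Cmod a * Cl_norm f).
  rewrite Cl_scal_val, Cmod_mult.
  apply Rmult_le_compat_l; [apply Cmod_ge_0 | now apply Cl_norm_ge].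
Qed.

Lemma Cl_norm_opp (f : Cl) : Cl_norm (opp f) = Cl_norm f.
Proof.
  assert (H : forall g : Cl, Cl_norm (opp g) <= Cl_norm g).
  { intros g. apply Cl_norm_le; intros x Hx.
    change (Cmod (Cl_opp g x) <= Cl_norm g).
    rewrite Cl_opp_val, Cmod_opp. now apply Cl_norm_ge. }
  apply Rle_antisym; [apply H |].
  rewrite <- (opp_opp f) at 1. apply H.
Qed.

Definition Cl_UniformSpace_mixin : UniformSpace.mixin_of Cl.
Proof.
  refine (UniformSpace.Mixin Cl Cl_zero (fun f e g => Cl_norm (minus g f) < e) _ _ _).
  - intros f e. rewrite minus_eq_zero. change (Cl_norm Cl_zero < e).
    rewrite Cl_norm_zero. apply cond_pos.
  - intros f g e H. rewrite <- Cl_norm_opp, opp_minus. exact H.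
  - intros f g h e1 e2 H1 H2.
    rewrite (minus_trans g).
    eapply Rle_lt_trans; [apply Cl_norm_plus | lra].
Defined.
Canonical Cl_UniformSpace := UniformSpace.Pack Cl Cl_UniformSpace_mixin Cl.

Canonical Cl_NormedModuleAux :=
  NormedModuleAux.Pack C_AbsRing Cl
    (NormedModuleAux.Class C_AbsRing Cl (ModuleSpace.class C_Ring Cl_ModuleSpace)
       Cl_UniformSpace_mixin) Cl.

Definition Cl_NormedModule_mixin : NormedModule.mixin_of C_AbsRing Cl_NormedModuleAux.
Proof.
  refine (NormedModule.Mixin C_AbsRing Cl_NormedModuleAux Cl_norm 1 _ _ _ _ _).
  - apply Cl_norm_plus.
  - apply Cl_norm_scal.
  - intros f g eps H; exact H.
  - intros f g eps H. rewrite Rmult_1_l; exact H.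
  - intros f Hf. apply Cl_ext; intros x Hx.
    apply Cmod_eq_0, Rle_antisym; [| apply Cmod_ge_0].
    rewrite <- Hf. now apply Cl_norm_ge.
Defined.
Canonical Cl_NormedModule :=
  NormedModule.Pack C_AbsRing Cl
    (NormedModule.Class C_AbsRing Cl (NormedModuleAux.class C_AbsRing Cl_NormedModuleAux)
       Cl_NormedModule_mixin) Cl.

Lemma Cl_complete_exists (F : (Cl -> Prop) -> Prop) :
  ProperFilter F -> cauchy F ->
  exists g : Cl, forall eps : posreal, F (ball g eps).
Proof.
  intros PF HF.
  pose (F' := filtermap (fun f : Cl => (f : R -> C_CompleteNormedModule)) F).
  assert (Hball : forall (f h : Cl) (e : posreal), ball f e h ->
            forall x, ball (M := C_UniformSpace) (f x) e (h x)).
  { intros f h e H x.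
    apply (norm_compat1 (V := C_NormedModule)).
    assert (Hx : forall y, 0 <= y -> Cmod (h y - f y)%C < e).
    { intros y Hy. eapply Rle_lt_trans; [| exact H].
      replace (h y - f y)%C with (Cl_plus h (Cl_opp f) y)
        by (rewrite Cl_plus_val, Cl_opp_val; reflexivity).
      exact (Cl_norm_ge (Cl_plus h (Cl_opp f)) y Hy). }
    change (Cmod (h x - f x)%C < e).
    destruct (Rlt_dec x 0) as [H0 | H0].
    - rewrite (Cl_neg h x H0), (Cl_neg f x H0). apply Hx; lra.
    - apply Hx; lra. }
  assert (Hlim := complete_cauchy_fct (U := C_CompleteNormedModule) F'
            (filtermap_proper_filter _ _ _ _ PF)).
  set (g := lim_fct F') in Hlim.
  assert (Hg : forall eps : posreal, F (fun f : Cl => ball g eps (f : R -> C_CompleteNormedModule))).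
  { apply Hlim. intros eps. destruct (HF eps) as [f Hf]. exists f.
    unfold F', filtermap. revert Hf. apply filter_imp.
    intros h Hh x. exact (Hball f h eps Hh x). }
  clear Hlim.
  assert (Hfl : filterlim (fun f : Cl => (f : R -> C_CompleteNormedModule)) F (locally g)).
  { apply (filterlim_locally (U := fct_UniformSpace R C_CompleteNormedModule)).
    exact Hg. }
  assert (Hpt : forall x, filterlim (fun f : Cl => f x) F (locally (T := C_UniformSpace) (g x))).
  { intros x. apply filterlim_locally. intros eps.
    generalize (Hg eps). apply filter_imp. intros f Hf. exact (Hf x). }
  assert (gneg : forall x, x < 0 -> g x = g 0).
  { intros x Hx.
    apply (filterlim_locally_unique (V := C_NormedModule) (F := F) (fun f : Cl => f x)).
    - apply Hpt.
    - apply (filterlim_ext (fun f : Cl => f 0)).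
      + intros f. symmetry. now apply Cl_neg.
      + apply Hpt. }
  assert (gcont : continuous_on (U := C_UniformSpace) (fun x => 0 <= x) g).
  { apply continuous_on_of_continuous. intros x _.
    destruct (filterlim_switch (U := C_CompleteNormedModule) F PF (locally x) _
                (fun f : Cl => (f : R -> C)) g (fun f : Cl => f x) Hfl) as [l [H1 H2]].
    - intros f. exact (Cl_continuous f x).
    - unfold continuous. replace (g x) with l; [exact H2 |].
      apply (filterlim_locally_unique (V := C_NormedModule) (F := F) (fun f : Cl => f x));
        [exact H1 | apply Hpt]. }
  assert (glim : exists l : C,
            filterlim (g : R -> C) (Rbar_locally p_infty) (locally l)).
  { destruct (filterlim_switch (U := C_CompleteNormedModule) F PF (Rbar_locally p_infty) _
                (fun f : Cl => (f : R -> C)) g at_infty Hfl) as [l [_ H2]].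
    - intros f. exact (at_infty_correct f).
    - exists l; exact H2. }
  exists (mkCl g gneg gcont glim). intros eps.
  assert (He : 0 < eps / 4) by (generalize (cond_pos eps); lra).
  generalize (Hg (mkposreal _ He)). apply filter_imp. intros f Hf.
  change (Cl_norm (Cl_plus f (Cl_opp (mkCl g gneg gcont glim))) < eps).
  apply Rle_lt_trans with (sqrt 2 * (eps / 4)).
  - apply Cl_norm_le. intros x Hx.
    rewrite Cl_plus_val, Cl_opp_val. apply Rlt_le.
    exact (C_NormedModule_mixin_compat2 (g x) (f x) (mkposreal _ He) (Hf x)).
  - assert (H2 : sqrt 2 < 2).
    { rewrite <- (sqrt_square 2) at 2 by lra. apply sqrt_lt_1; lra. }
    generalize (cond_pos eps); intros Hp.
    apply Rlt_trans with (2 * (eps / 4)); [| lra].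
    apply Rmult_lt_compat_r; assumption.
Qed.

Definition Cl_complete_lim (F : (Cl -> Prop) -> Prop) : Cl :=
  epsilon (inhabits Cl_zero) (fun g => forall eps : posreal, F (ball g eps)).

Definition Cl_CompleteSpace_mixin : CompleteSpace.mixin_of Cl_UniformSpace.
Proof.
  refine (CompleteSpace.Mixin Cl_UniformSpace Cl_complete_lim _ _).
  - intros F PF HF.
    apply (epsilon_spec (inhabits Cl_zero) (fun g => forall eps : posreal, F (ball g eps))).
    now apply Cl_complete_exists.
  - intros F1 F2 H1 H2.
    assert (E : F1 = F2).
    { apply functional_extensionality; intros P.
      apply propositional_extensionality; split; [apply H2 | apply H1]. }
    rewrite E. apply close_refl.
Defined.

Canonical Cl_CompleteNormedModule :=
  CompleteNormedModule.Pack C_AbsRing Cl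
    (CompleteNormedModule.Class C_AbsRing Cl (NormedModule.class C_AbsRing Cl_NormedModule)
       Cl_CompleteSpace_mixin) Cl.

Definition cesaro_fun (f : R -> C) (x : R) : C :=
  if Rlt_dec 0 x
  then (RtoC (/ x) * RInt (V := C_R_CompleteNormedModule) f 0 x)%C
  else f 0.

Lemma Cl_ex_RInt (f : Cl) (a b : R) :
  ex_RInt (V := C_R_CompleteNormedModule) f a b.
Proof.
  apply (ex_RInt_continuous (V := C_R_CompleteNormedModule)).
  intros z _. exact (Cl_continuous f z).
Qed.

Lemma cesaro_fun_pos (f : R -> C) (x : R) : 0 < x ->
  cesaro_fun f x = (RtoC (/ x) * RInt (V := C_R_CompleteNormedModule) f 0 x)%C.
Proof. intros Hx. unfold cesaro_fun. destruct (Rlt_dec 0 x); [reflexivity | lra]. Qed.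

Lemma cesaro_fun_npos (f : R -> C) (x : R) : x <= 0 -> cesaro_fun f x = f 0.
Proof. intros Hx. unfold cesaro_fun. destruct (Rlt_dec 0 x); [lra | reflexivity]. Qed.

Lemma Cmod_RInt_le (f : Cl) (a b M : R) : a <= b ->
  (forall t, a <= t <= b -> Cmod (f t) <= M) ->
  Cmod (RInt (V := C_R_CompleteNormedModule) f a b) <= (b - a) * M.
Proof.
  intros Hab H. rewrite <- Cmod_C_R_norm.
  apply (norm_RInt_le (V := C_R_NormedModule) f (fun _ => M) a b _ _ Hab).
  - intros x Hx. rewrite Cmod_C_R_norm. now apply H.
  - apply (RInt_correct (V := C_R_CompleteNormedModule)), Cl_ex_RInt.
  - apply (is_RInt_const (V := R_NormedModule) a b M).
Qed.

Lemma RInt_Cl_lin (a b : C) (f g : Cl) (x : R) :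
  RInt (V := C_R_CompleteNormedModule) (Cl_lin a b f g) 0 x =
  (a * RInt (V := C_R_CompleteNormedModule) f 0 x
   + b * RInt (V := C_R_CompleteNormedModule) g 0 x)%C.
Proof.
  assert (P : forall h : Cl, is_RInt (V := C_R_CompleteNormedModule) h 0 x
                (RInt (V := C_R_CompleteNormedModule) h 0 x)).
  { intros h. apply RInt_correct, Cl_ex_RInt. }
  assert (M : forall (c : C) (h : Cl) (l : C),
            is_RInt (V := C_R_NormedModule) h 0 x l ->
            is_RInt (V := C_R_NormedModule) (fun t => c * h t)%C 0 x (c * l)%C).
  { intros c h l H.
    generalize (is_RInt_fct_extend_fst (U := R_NormedModule) (V := R_NormedModule) _ _ _ _ H)
               (is_RInt_fct_extend_snd (U := R_NormedModule) (V := R_NormedModule) _ _ _ _ H).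
    intros H1 H2.
    apply (is_RInt_fct_extend_pair (U := R_NormedModule) (V := R_NormedModule)); simpl.
    - exact (is_RInt_minus (V := R_NormedModule) _ _ _ _ _ _
               (is_RInt_scal _ _ _ (fst c) _ H1) (is_RInt_scal _ _ _ (snd c) _ H2)).
    - exact (is_RInt_plus (V := R_NormedModule) _ _ _ _ _ _
               (is_RInt_scal _ _ _ (fst c) _ H2) (is_RInt_scal _ _ _ (snd c) _ H1)). }
  apply (is_RInt_unique (V := C_R_CompleteNormedModule)).
  exact (is_RInt_plus (V := C_R_NormedModule) _ _ _ _ _ _ (M a f _ (P f)) (M b g _ (P g))).
Qed.

Lemma RInt_Cl_const (c : C) (x : R) :
  RInt (V := C_R_CompleteNormedModule) (Cl_const c) 0 x = (RtoC x * c)%C.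
Proof.
  apply (is_RInt_unique (V := C_R_CompleteNormedModule)).
  rewrite <- scal_R_Cmult.
  generalize (is_RInt_const (V := C_R_NormedModule) 0 x c).
  now rewrite Rminus_0_r.
Qed.

Lemma RtoC_inv_l (x : R) : 0 < x -> (RtoC (/ x) * RtoC x)%C = RtoC 1.
Proof. intros Hx. rewrite <- RtoC_mult. f_equal. field; lra. Qed.

Lemma cesaro_fun_lin (a b : C) (f g : Cl) (x : R) :
  cesaro_fun (Cl_lin a b f g) x = (a * cesaro_fun f x + b * cesaro_fun g x)%C.
Proof.
  destruct (Rlt_dec 0 x) as [Hx | Hx].
  - rewrite !cesaro_fun_pos, RInt_Cl_lin by assumption. ring.
  - rewrite !cesaro_fun_npos by lra. reflexivity.
Qed.

Lemma cesaro_fun_const (c : C) (x : R) : cesaro_fun (Cl_const c) x = c.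
Proof.
  destruct (Rlt_dec 0 x) as [Hx | Hx].
  - rewrite cesaro_fun_pos, RInt_Cl_const, Cmult_assoc, RtoC_inv_l by assumption. ring.
  - rewrite cesaro_fun_npos by lra. reflexivity.
Qed.

Lemma cesaro_fun_minus_const (f : Cl) (c : C) (x : R) :
  (cesaro_fun f x - c)%C = cesaro_fun (Cl_lin 1 (-1) f (Cl_const c)) x.
Proof. rewrite cesaro_fun_lin, cesaro_fun_const. ring. Qed.

Lemma Cmod_cesaro_fun_le (f : Cl) (x M : R) :
  (forall t, 0 <= t -> t <= x \/ t = 0 -> Cmod (f t) <= M) ->
  Cmod (cesaro_fun f x) <= M.
Proof.
  intros H. destruct (Rlt_dec 0 x) as [Hx | Hx].
  - rewrite cesaro_fun_pos, Cmod_mult, Cmod_R by assumption.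
    assert (Hi : 0 < / x) by now apply Rinv_0_lt_compat.
    rewrite Rabs_pos_eq by lra.
    apply Rle_trans with (/ x * ((x - 0) * M)).
    + apply Rmult_le_compat_l; [lra |]. apply Cmod_RInt_le; [lra |].
      intros t Ht. apply H; lra.
    + right. field. lra.
  - rewrite cesaro_fun_npos by lra. apply H; [lra | now right].
Qed.

Lemma cesaro_fun_neg (f : Cl) (x : R) : x < 0 -> cesaro_fun f x = cesaro_fun f 0.
Proof. intros Hx. now rewrite !cesaro_fun_npos by lra. Qed.

Lemma cesaro_fun_cont (f : Cl) : continuous_on (fun x => 0 <= x) (cesaro_fun f).
Proof.
  apply continuous_on_of_continuous. intros x Hx.
  destruct (Rle_lt_or_eq_dec 0 x Hx) as [Hx0 | <-].
  - apply (continuous_ext_loc (T := R_UniformSpace) (U := C_UniformSpace) _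
      (fun y => scal (V := C_R_NormedModule) (/ y)
                  (RInt (V := C_R_CompleteNormedModule) f 0 y))).
    + exists (mkposreal x Hx0). intros y Hy.
      change (Rabs (y - x) < x) in Hy. apply Rabs_def2 in Hy.
      rewrite cesaro_fun_pos by lra. apply scal_R_Cmult.
    + apply (continuous_scal (K := R_AbsRing) (V := C_R_NormedModule)).
      * apply (continuous_Rinv x). lra.
      * apply (continuous_RInt_1 (V := C_R_NormedModule) f 0 x).
        apply filter_forall. intros z.
        apply (RInt_correct (V := C_R_CompleteNormedModule)), Cl_ex_RInt.
  - apply filterlim_C_eps. intros eps Heps.
    assert (He : 0 < eps / 2) by lra.
    destruct (proj1 (filterlim_C_eps f (f 0)) (Cl_continuous f 0) _ He) as [d Hd].
    exists d. intros y Hy. change (Rabs (y - 0) < d) in Hy. apply Rabs_def2 in Hy.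
    rewrite (cesaro_fun_npos f 0), cesaro_fun_minus_const by lra.
    apply Rle_lt_trans with (eps / 2); [| lra].
    apply Cmod_cesaro_fun_le. intros t Ht Hty.
    replace (Cl_lin 1 (-1) f (Cl_const (f 0)) t) with (f t - f 0)%C by (simpl; ring).
    apply Rlt_le, Hd. change (Rabs (t - 0) < d).
    apply Rabs_def1; generalize (cond_pos d); lra.
Qed.

Lemma cesaro_fun_lim_infty (f : Cl) :
  filterlim (cesaro_fun f) (Rbar_locally p_infty) (locally (at_infty f)).
Proof.
  apply filterlim_C_eps. intros eps Heps.
  set (h := Cl_lin 1 (-1) f (Cl_const (at_infty f))).
  assert (He : 0 < eps / 2) by lra.
  destruct (proj1 (filterlim_C_eps f _) (at_infty_correct f) _ He) as [A0 HA0].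
  set (A := Rmax A0 0 + 1).
  assert (HA : A0 < A /\ 0 < A)
    by (generalize (Rmax_l A0 0) (Rmax_r A0 0); unfold A; lra).
  set (K := Cmod (RInt (V := C_R_CompleteNormedModule) h 0 A)).
  assert (HK : 0 <= K) by apply Cmod_ge_0.
  exists (Rmax A (2 * K / eps)). intros x Hx.
  assert (HxA : A < x) by (eapply Rle_lt_trans; [apply Rmax_l | exact Hx]).
  assert (HxK : 2 * K / eps < x) by (eapply Rle_lt_trans; [apply Rmax_r | exact Hx]).
  rewrite cesaro_fun_minus_const. fold h.
  rewrite cesaro_fun_pos, Cmod_mult, Cmod_R by lra.
  assert (Hi : 0 < / x) by (apply Rinv_0_lt_compat; lra).
  rewrite Rabs_pos_eq by lra.
  rewrite <- (RInt_Chasles (V := C_R_CompleteNormedModule) h 0 A x) by apply Cl_ex_RInt.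
  assert (HI : Cmod (RInt (V := C_R_CompleteNormedModule) h A x) <= (x - A) * (eps / 2)).
  { apply Cmod_RInt_le; [lra |]. intros t Ht.
    replace (h t) with (f t - at_infty f)%C by (unfold h; simpl; ring).
    apply Rlt_le, HA0. lra. }
  assert (HS : Cmod (plus (G := C_R_CompleteNormedModule)
                       (RInt (V := C_R_CompleteNormedModule) h 0 A)
                       (RInt (V := C_R_CompleteNormedModule) h A x)) < x * eps).
  { eapply Rle_lt_trans; [apply Cmod_triangle |]. fold K.
    apply Rmult_lt_compat_r with (r := eps) in HxK; [| lra].
    replace (2 * K / eps * eps) with (2 * K) in HxK by (field; lra).
    assert (0 < A * (eps / 2)) by (apply Rmult_lt_0_compat; lra).
    lra. }
  apply Rmult_lt_compat_l with (r := / x) in HS; [| lra].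
  replace (/ x * (x * eps)) with eps in HS by (field; lra).
  exact HS.
Qed.

Lemma cesaro_fun_lim (f : Cl) :
  exists l : C, filterlim (cesaro_fun f) (Rbar_locally p_infty) (locally l).
Proof. exists (at_infty f). apply cesaro_fun_lim_infty. Qed.

Definition cesaro_op (f : Cl) : Cl :=
  mkCl (cesaro_fun f) (cesaro_fun_neg f) (cesaro_fun_cont f) (cesaro_fun_lim f).

Definition closure {U : UniformSpace} (A : U -> Prop) (y : U) : Prop :=
  forall V : U -> Prop, locally y V -> exists x : U, A x /\ V x.

Record BoundedOperator (X : CompleteNormedModule C_AbsRing) : Type := mkBoundedOperator {
  op_fun :> X -> X;
  op_linear : is_linear op_fun
}.

Lemma cesaro_linear : is_linear (U := Cl_NormedModule) (V := Cl_NormedModule) cesaro_op.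
Proof.
  split.
  - intros f g. apply Cl_ext. intros x _. exact (cesaro_fun_lin 1 1 f g x).
  - intros a f. apply Cl_ext. intros x _. exact (cesaro_fun_lin a 0 f f x).
  - exists 1. split; [lra |]. intros f. rewrite Rmult_1_l.
    apply (Cl_norm_le (cesaro_op f)). intros x Hx.
    apply Cmod_cesaro_fun_le. intros t Ht _. now apply Cl_norm_ge.
Qed.

Definition cesaro : BoundedOperator Cl_CompleteNormedModule :=
  mkBoundedOperator Cl_CompleteNormedModule cesaro_op cesaro_linear.

Section Operators.

Context {X : CompleteNormedModule C_AbsRing}.

Definition op_pow (T : X -> X) (n : nat) : X -> X := fun x => Nat.iter n T x.

Definition op_norm (T : X -> X) : Rbar :=
  Lub_Rbar (fun r => exists x : X, norm x <= 1 /\ r = norm (T x)).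

(* The powers are indexed from 1, as in [sup_{n >= 1} ||T^n||]. *)
Definition power_bounded (T : BoundedOperator X) : Prop :=
  Rbar_lt (Sup_seq (fun n => op_norm (op_pow T (S n)))) p_infty.

(* [T_[n]]; only [n >= 1] is meaningful, which is enough for limits in [n]. *)
Definition cesaro_mean (T : X -> X) (n : nat) (x : X) : X :=
  scal (RtoC (/ INR n)) (sum_n_m (fun m => op_pow T m x) 1 n).

Definition mean_ergodic (T : BoundedOperator X) : Prop :=
  exists P : BoundedOperator X,
    forall x : X, filterlim (fun n => cesaro_mean T n x) eventually (locally (P x)).

(* Separability of [X] is not assumed: it follows from the existence of such an [x]. *)
Definition hypercyclic (T : BoundedOperator X) : Prop :=
  exists x : X, forall y : X,
    closure (fun z => exists n : nat, z = op_pow T n x) y.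

Definition range_I_minus (T : X -> X) (y : X) : Prop :=
  exists x : X, y = minus x (T x).

End Operators.

(* Main.v *)
(* [C] is a contraction and both evaluations [f |-> f 0] and [f |-> f oo] are bounded
   [C]-invariant functionals. They are therefore constant on orbits (so no orbit is dense)
   and vanish on the closed range of [I - C]. A limit [g] of Cesaro means of an [f] with
   [f 0 = 0], [f oo = 1] would keep these values and be fixed by [C]; but fixed points of
   [C] are constant. Conversely, [h - C h = g] is solved by [h x = g x + int_0^x g(t)/t dt]
   as soon as [g(t)/t] is continuous with compact support, and such [g] approximate every
   [f] with [f 0 = f oo = 0]. *)

Require Import Defs.
From Stdlib Require Import Reals.
From Coquelicot Require Import Coquelicot.
From Stdlib Require Import Lra Lia.

(** * Bounded linear maps invariant under an operator *)

(** By continuity of [phi], points of [A] near [y] put [c] in every ball around [phi y], and in a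
    normed module such close points are equal. *)
Lemma closure_linear_const {X : CompleteNormedModule C_AbsRing}
    {V : NormedModule C_AbsRing} (phi : X -> V) (c : V) (A : X -> Prop) (y : X) :
  is_linear phi -> (forall z, A z -> phi z = c) -> closure A y -> phi y = c.
Proof.
  intros Hphi HA Hy. apply eq_close. intros eps.
  destruct (Hy _ (linear_cont phi y Hphi _ (locally_ball (phi y) eps)))
    as [z [Az Hz]].
  now rewrite (HA z Az) in Hz.
Qed.

Lemma closure_range_I_minus_invariant {X : CompleteNormedModule C_AbsRing}
    {V : NormedModule C_AbsRing} (T : X -> X) (phi : X -> V) (y : X) :
  is_linear phi -> (forall z, phi (T z) = phi z) ->
  closure (range_I_minus T) y -> phi y = zero.
Proof.
  intros Hphi H. apply closure_linear_const; [exact Hphi |].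
  intros z [x ->]. rewrite (linear_minus phi _ _ Hphi), H. apply (minus_eq_zero (G := V)).
Qed.

Lemma op_pow_invariant {X : CompleteNormedModule C_AbsRing} {V : Type}
    (T : X -> X) (phi : X -> V) (n : nat) (x : X) :
  (forall z, phi (T z) = phi z) -> phi (op_pow T n x) = phi x.
Proof.
  intros H. induction n as [|n IH]; [reflexivity |].
  change (phi (T (op_pow T n x)) = phi x). now rewrite H.
Qed.

(** Each power in the sum contributes one copy of [phi x], and the average of equal terms is that
    term. The index [S n] avoids 0, where the mean is an empty sum and hence zero. *)
Lemma cesaro_mean_invariant {X : CompleteNormedModule C_AbsRing}
    {V : NormedModule C_AbsRing} (T : X -> X) (phi : X -> V) (n : nat) (x : X) :
  is_linear phi -> (forall z, phi (T z) = phi z) ->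
  phi (cesaro_mean T (S n) x) = phi x.
Proof.
  intros Hphi H. unfold cesaro_mean. rewrite (linear_scal phi Hphi).
  assert (E : forall m, phi (sum_n_m (fun k => op_pow T k x) 1 m)
                        = scal (RtoC (INR m)) (phi x)).
  { induction m as [|m IH].
    - rewrite sum_n_m_zero by lia. etransitivity; [apply (linear_zero phi Hphi) |].
      symmetry. apply (scal_zero_l (phi x)).
    - rewrite sum_n_Sm, (linear_plus phi Hphi), IH, op_pow_invariant by (assumption || lia).
      rewrite S_INR, RtoC_plus.
      rewrite <- (scal_one (phi x)) at 2. symmetry.
      apply (scal_distr_r (RtoC (INR m)) (RtoC 1) (phi x)). }
  rewrite E, scal_assoc.
  transitivity (scal (V := V) (RtoC 1) (phi x)); [| apply (scal_one (phi x))].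
  f_equal. apply RtoC_inv_l, lt_0_INR. lia.
Qed.

Lemma limit_cesaro_mean_invariant {X : CompleteNormedModule C_AbsRing}
    {V : NormedModule C_AbsRing} (T : X -> X) (phi : X -> V) (x y : X) :
  is_linear phi -> (forall z, phi (T z) = phi z) ->
  filterlim (fun n => cesaro_mean T n x) eventually (locally y) ->
  phi y = phi x.
Proof.
  intros Hphi H Hy.
  apply (filterlim_locally_unique (F := eventually)
           (fun n => phi (cesaro_mean T n x))).
  - exact (filterlim_comp _ _ _ _ phi _ _ _ Hy (linear_cont phi y Hphi)).
  - apply (filterlim_ext_loc (fun _ => phi x)); [| apply filterlim_const].
    exists 1%nat. intros [|n] Hn; [lia |]. symmetry. now apply cesaro_mean_invariant.
Qed.

(** * Limits of Cesàro means are fixed points; contractions are power bounded *)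

Lemma minus_zero_eq {G : AbelianGroup} (a b : G) : minus a b = zero -> a = b.
Proof.
  intros H. apply (plus_reg_r (opp b)). etransitivity; [exact H |].
  symmetry. apply plus_opp_r.
Qed.

(** The differences come out in the order in which [minus_trans] chains them in the telescoping
    induction. *)
Lemma minus_plus_plus {G : AbelianGroup} (a b c d : G) :
  minus (plus a b) (plus c d) = plus (minus b d) (minus a c).
Proof.
  unfold minus. rewrite opp_plus, (plus_comm a b), <- !plus_assoc. f_equal.
  now rewrite (plus_comm (opp d)), !plus_assoc.
Qed.

(** [T] shifts the sum of the powers 1 to n by one, so only the new last term and the old first term
    survive the subtraction. *)
Lemma cesaro_mean_telescope {X : CompleteNormedModule C_AbsRing}
    (T : BoundedOperator X) (n : nat) (x : X) :
  minus (T (cesaro_mean T n x)) (cesaro_mean T n x)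
  = scal (RtoC (/ INR n)) (minus (op_pow T (S n) x) (T x)).
Proof.
  assert (HT := op_linear X T).
  unfold cesaro_mean. rewrite (linear_scal T HT).
  etransitivity; [symmetry; apply (scal_minus_distr_l (V := X)) |]. f_equal.
  induction n as [|n IH].
  - rewrite sum_n_m_zero by lia.
    etransitivity; [apply (f_equal (fun z => minus z zero) (linear_zero T HT)) |].
    etransitivity; [| symmetry; apply (minus_eq_zero (G := X))]. apply minus_zero_r.
  - rewrite sum_n_Sm, (linear_plus T HT) by lia.
    change (T (op_pow T (S n) x)) with (op_pow T (S (S n)) x).
    etransitivity; [apply (minus_plus_plus (G := X)) |].
    etransitivity; [| symmetry; apply (minus_trans (G := X) (op_pow T (S n) x))].
    apply (f_equal (plus _)), IH.
Qed.

(** [T y - y] is the limit of [d], which tends to zero because the telescoped difference stays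
    bounded while it is divided by n. *)
Lemma limit_cesaro_mean_fixed {X : CompleteNormedModule C_AbsRing}
    (T : BoundedOperator X) (M : R) (x y : X) :
  (forall n, norm (op_pow T n x) <= M) ->
  filterlim (fun n => cesaro_mean T n x) eventually (locally y) ->
  T y = y.
Proof.
  intros HM Hy. assert (HT := op_linear X T).
  set (d := fun n => minus (T (cesaro_mean T n x)) (cesaro_mean T n x)).
  assert (E : minus (T y) y = zero).
  { apply (filterlim_locally_unique (F := eventually) d).
    - apply (filterlim_comp_2 (F := eventually) (H := locally (opp y)) (G := locally (T y))
        (fun n => T (cesaro_mean T n x)) (fun n => opp (cesaro_mean T n x))
        plus).
      + exact (filterlim_comp _ _ _ _ T _ _ _ Hy (linear_cont T y HT)).
      + exact (filterlim_comp _ _ _ _ opp _ _ _ Hy (filterlim_opp y)).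
      + exact (filterlim_plus (V := X) (T y) (opp y)).
    - refine (filterlim_norm_zero (V := X) (F := eventually) d _).
      (* Squeeze between 0 and 2M/n. The estimate also covers n = 0, where the convention that the
         inverse of 0 is 0 makes both sides vanish. *)
      apply (is_lim_seq_le_le (fun _ => 0) _ (fun n => (2 * M) * / INR n) 0).
      + intros n. split; [apply norm_ge_0 |].
        unfold d. rewrite cesaro_mean_telescope.
        eapply Rle_trans; [apply (norm_scal (V := X)) |].
        change (Cmod (RtoC (/ INR n)) * norm (minus (op_pow T (S n) x) (T x))
                <= 2 * M * / INR n).
        rewrite Cmod_R, Rabs_pos_eq, Rmult_comm.
        * apply Rmult_le_compat_r.
          -- destruct n; [simpl; rewrite Rinv_0; lra |].
             left; apply Rinv_0_lt_compat, lt_0_INR; lia.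
          -- eapply Rle_trans; [apply (norm_triangle (V := X)) |].
             rewrite (norm_opp (V := X)).
             generalize (HM (S n)) (HM 1%nat). change (op_pow T 1 x) with (T x). lra.
        * destruct n; [simpl; rewrite Rinv_0; lra |].
          left; apply Rinv_0_lt_compat, lt_0_INR; lia.
      + apply is_lim_seq_const.
      + replace (Finite 0) with (Rbar_mult (2 * M) (Rbar_inv p_infty))
          by (simpl; f_equal; ring).
        apply is_lim_seq_scal_l, is_lim_seq_inv; [apply is_lim_seq_INR | discriminate]. }
  exact (minus_zero_eq (G := X) _ _ E).
Qed.

Lemma power_bounded_of_contraction {X : CompleteNormedModule C_AbsRing}
    (T : BoundedOperator X) :
  (forall x, norm (T x) <= norm x) -> power_bounded T.
Proof.
  intros HT.
  assert (Hn : forall n, Rbar_le (op_norm (op_pow T n)) 1).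
  { intros n. apply (proj2 (Lub_Rbar_correct _)). intros r [x [Hx ->]]. simpl.
    apply Rle_trans with (2 := Hx). clear Hx. induction n as [|n IH]; [apply Rle_refl |].
    eapply Rle_trans; [apply HT | exact IH]. }
  unfold power_bounded.
  (* Only the value [p_infty] needs an argument: it would yield a power of norm greater than 1. *)
  generalize (Sup_seq_correct (fun n => op_norm (op_pow T (S n)))).
  destruct (Sup_seq _) as [l | |]; intros H; try exact I.
  destruct (H 1) as [n Hl]. now apply Rbar_le_not_lt in Hl.
Qed.

(** * The evaluations at 0 and at infinity, and the contraction property *)

Lemma Cl_minus_val (f g : Cl) (x : R) : minus f g x = (f x - g x)%C.
Proof. change (Cl_plus f (Cl_opp g) x = (f x - g x)%C). simpl. ring. Qed.

Lemma closure_Cl (A : Cl -> Prop) (f : Cl) :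
  (forall eps, 0 < eps -> exists g, A g /\ Cl_norm (minus g f) < eps) ->
  closure A f.
Proof.
  intros H V [eps HV]. destruct (H eps (cond_pos eps)) as [g [Ag Hg]].
  exists g. split; [exact Ag | now apply HV].
Qed.

Lemma at_infty_lin (a b : C) (f g : Cl) :
  at_infty (Cl_lin a b f g) = (a * at_infty f + b * at_infty g)%C.
Proof. apply at_infty_unique, filterlim_lin; apply at_infty_correct. Qed.

Lemma Cmod_at_infty_le (f : Cl) : Cmod (at_infty f) <= Cl_norm f.
Proof.
  apply le_epsilon. intros eps Heps.
  destruct (proj1 (filterlim_C_eps f _) (at_infty_correct f) eps Heps) as [A HA].
  (* A point strictly beyond [A], and on the half-line, where the norm controls the values of
     [f]. *)
  set (x := Rmax A 0 + 1).
  assert (Hx : A < x /\ 0 <= x)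
    by (generalize (Rmax_l A 0) (Rmax_r A 0); unfold x; lra).
  replace (at_infty f) with (f x + - (f x - at_infty f))%C by ring.
  eapply Rle_trans; [apply Cmod_triangle |]. rewrite Cmod_opp.
  apply Rplus_le_compat; [now apply Cl_norm_ge | now apply Rlt_le, HA].
Qed.

Lemma eval_0_linear :
  is_linear (U := Cl_NormedModule) (V := C_NormedModule) (fun f : Cl => f 0).
Proof.
  split.
  - intros f g. exact (Cl_plus_val f g 0).
  - intros a f. exact (Cl_scal_val a f 0).
  - exists 1. split; [lra |]. intros f. rewrite Rmult_1_l.
    apply (Cl_norm_ge f 0), Rle_refl.
Qed.

Lemma at_infty_linear :
  is_linear (U := Cl_NormedModule) (V := C_NormedModule) at_infty.
Proof.
  split.
  - intros f g. change (at_infty (Cl_lin 1 1 f g) = (at_infty f + at_infty g)%C).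
    rewrite at_infty_lin. ring.
  - intros a f. change (at_infty (Cl_lin a 0 f f) = (a * at_infty f)%C).
    rewrite at_infty_lin. ring.
  - exists 1. split; [lra |]. intros f. rewrite Rmult_1_l. apply (Cmod_at_infty_le f).
Qed.

Lemma cesaro_eval_0 (f : Cl) : cesaro f 0 = f 0.
Proof. apply cesaro_fun_npos. lra. Qed.

Lemma at_infty_cesaro (f : Cl) : at_infty (cesaro f) = at_infty f.
Proof. apply at_infty_unique. apply cesaro_fun_lim_infty. Qed.

Lemma cesaro_contraction (f : Cl) : Cl_norm (cesaro f) <= Cl_norm f.
Proof.
  apply Cl_norm_le. intros x Hx. apply Cmod_cesaro_fun_le.
  intros t Ht _. now apply Cl_norm_ge.
Qed.

Lemma cesaro_pow_norm_le (f : Cl) (n : nat) : Cl_norm (op_pow cesaro n f) <= Cl_norm f.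
Proof.
  induction n as [|n IH]; [apply Rle_refl |].
  eapply Rle_trans; [apply cesaro_contraction | exact IH].
Qed.

(** * Calculus: fixed points of the Cesàro operator and the equation h - C h = g *)

Lemma is_derive_RInt_C (k : R -> C) (x : R) :
  (forall t, continuous k t) ->
  is_derive (V := C_R_NormedModule)
    (fun y => RInt (V := C_R_CompleteNormedModule) k 0 y) x (k x).
Proof.
  intros Hk. apply (is_derive_RInt (V := C_R_NormedModule)) with 0; [| apply Hk].
  apply filter_forall. intros y. apply (RInt_correct (V := C_R_CompleteNormedModule)).
  apply (ex_RInt_continuous (V := C_R_CompleteNormedModule)). intros; apply Hk.
Qed.

(* Since [G x = int_0^x f] satisfies [G' = G / x], the quotient [G / x] has zero derivative. *)
Lemma cesaro_fixed_constant (f : Cl) (a b : R) :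
  cesaro f = f -> 0 < a -> a <= b -> f a = f b.
Proof.
  intros Hf Ha Hab.
  set (G := fun y => RInt (V := C_R_CompleteNormedModule) f 0 y).
  assert (HG : forall x, 0 < x -> f x = scal (V := C_R_NormedModule) (/ x) (G x)).
  { intros x Hx. rewrite <- Hf at 1. etransitivity; [apply (cesaro_fun_pos f x Hx) |].
    symmetry. apply scal_R_Cmult. }
  assert (Hpos : forall t, Rmin a b <= t <= Rmax a b -> 0 < t)
    by (rewrite Rmin_left, Rmax_right by lra; intros; lra).
  assert (H1 : is_RInt (V := C_R_CompleteNormedModule)
    (fun t => plus (scal (- / t ^ 2) (G t)) (scal (/ t) (f t))) a b
    (minus (scal (/ b) (G b)) (scal (/ a) (G a)))).
  { apply (is_RInt_scal_derive (V := C_R_CompleteNormedModule) (fun t => / t) G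
             (fun t => - / t ^ 2) f).
    - intros t Ht. apply Hpos in Ht. auto_derive; [lra | field; lra].
    - intros t _. apply is_derive_RInt_C, Cl_continuous.
    - intros t Ht. apply Hpos in Ht. apply (continuous_opp (V := R_NormedModule)).
      apply continuous_Rinv_comp; [| apply pow_nonzero; lra].
      apply (ex_derive_continuous (V := R_NormedModule)). auto_derive. exact I.
    - intros t _. apply Cl_continuous. }
  (* The integral of the derivative of G(t)/t is computed a second time: substituting f(t) = G(t)/t
     makes its two terms cancel, so the boundary values in [H1] agree. *)
  assert (H2 : is_RInt (V := C_R_CompleteNormedModule)
    (fun t => plus (scal (- / t ^ 2) (G t)) (scal (/ t) (f t))) a b
    (scal (b - a) zero)).
  { apply (is_RInt_ext (V := C_R_CompleteNormedModule) (fun _ => zero)).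
    - intros t Ht. assert (Ht0 : 0 < t) by (apply Hpos; lra).
      rewrite (HG t Ht0), scal_assoc, <- (scal_distr_r (V := C_R_NormedModule)).
      assert (Z : plus (- / t ^ 2) (mult (/ t) (/ t)) = zero)
        by (unfold plus, mult, zero; simpl; field; lra).
      symmetry. etransitivity; [apply (f_equal (fun c => scal c (G t)) Z) |].
      apply (scal_zero_l (V := C_R_NormedModule)).
    - apply (is_RInt_const (V := C_R_NormedModule)). }
  assert (E := is_RInt_unique (V := C_R_CompleteNormedModule) _ _ _ _ H1).
  rewrite (is_RInt_unique (V := C_R_CompleteNormedModule) _ _ _ _ H2) in E.
  symmetry. apply (minus_zero_eq (G := C_R_NormedModule)).
  rewrite (HG a), (HG b) by lra. etransitivity; [symmetry; exact E |].
  apply (scal_zero_r (V := C_R_NormedModule)).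
Qed.

(* Solving [h - C h = g] with [g x = x k x] gives [C h x = int_0^x k], hence
   [h x = x k x + int_0^x k]. *)
Lemma range_I_minus_cesaro_of_compact_support (k : R -> C) (B : R) :
  (forall x, continuous k x) -> (forall x, x < 0 -> k x = 0) ->
  (forall x, B <= x -> k x = 0) ->
  exists h : Cl, forall x, 0 <= x -> minus h (cesaro h) x = (x * k x)%C.
Proof.
  intros Hk Hneg HB.
  set (P := fun y => RInt (V := C_R_CompleteNormedModule) k 0 y : C).
  assert (Hex : forall a b, ex_RInt (V := C_R_CompleteNormedModule) k a b).
  { intros. apply (ex_RInt_continuous (V := C_R_CompleteNormedModule)). intros; apply Hk. }
  assert (HP : forall x, is_derive (V := C_R_NormedModule) P x (k x))
    by (intros; now apply is_derive_RInt_C).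
  (* The primitive is constant wherever [k] vanishes; this gives [h] its constant values on the
     negative axis and its limit [P B] at infinity. *)
  assert (Hconst : forall a b, (forall x, Rmin a b < x < Rmax a b -> k x = 0) -> P a = P b).
  { intros a b H.
    assert (Z : RInt (V := C_R_CompleteNormedModule) k a b = zero).
    { etransitivity;
        [apply (RInt_ext (V := C_R_CompleteNormedModule) k (fun _ => zero)), H |].
      etransitivity; [apply RInt_const | apply (scal_zero_r (V := C_R_NormedModule))]. }
    symmetry. etransitivity;
      [symmetry; apply (RInt_Chasles (V := C_R_CompleteNormedModule) k 0 a b); apply Hex |].
    rewrite Z. apply (plus_zero_r (G := C_R_NormedModule)). }
  (* The factor 1 is kept so that [h] is literally the product-rule derivative of x P(x), as
     [is_RInt_scal_derive] expects it below. *)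
  set (h := fun x => plus (G := C_R_NormedModule) (scal 1 (P x)) (scal x (k x)) : C).
  assert (Hh : forall x, h x = (P x + x * k x)%C).
  { intros x. unfold h. rewrite (scal_one (V := C_R_NormedModule)).
    apply (f_equal (Cplus (P x))), scal_R_Cmult. }
  assert (hcont : forall x, continuous h x).
  { intros x. apply (continuous_plus (V := C_R_NormedModule)).
    - apply (continuous_scal_r (V := C_R_NormedModule)).
      apply (ex_derive_continuous (V := C_R_NormedModule)). eexists; apply HP.
    - apply (continuous_scal (V := C_R_NormedModule)); [apply continuous_id | apply Hk]. }
  assert (hneg : forall x, x < 0 -> h x = h 0).
  { intros x Hx. rewrite !Hh, (Hneg x Hx), (Hconst x 0); [ring |].
    rewrite Rmin_left, Rmax_right by lra. intros; apply Hneg; lra. }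
  assert (hlim : exists l : C, filterlim h (Rbar_locally p_infty) (locally l)).
  { exists (P B). apply (filterlim_ext_loc (fun _ => P B)); [| apply filterlim_const].
    exists B. intros x Hx. rewrite Hh, (HB x) by lra.
    rewrite (Hconst B x) by (rewrite Rmin_left, Rmax_right by lra; intros; apply HB; lra).
    ring. }
  exists (mkCl h hneg (continuous_on_of_continuous h (fun x _ => hcont x)) hlim).
  intros x Hx. rewrite Cl_minus_val. simpl.
  destruct Hx as [Hx | <-].
  - rewrite (cesaro_fun_pos h x Hx).
    replace (RInt (V := C_R_CompleteNormedModule) h 0 x) with (x * P x)%C.
    + rewrite Hh, Cmult_assoc, RtoC_inv_l by assumption. ring.
    + symmetry. apply (is_RInt_unique (V := C_R_CompleteNormedModule)).
      replace (x * P x)%C with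
        (minus (G := C_R_NormedModule) (scal x (P x)) (scal 0 (P 0))).
      * apply (is_RInt_scal_derive (V := C_R_CompleteNormedModule) (fun t => t) P
                 (fun _ => 1) k).
        -- intros t _. apply (is_derive_id (K := R_AbsRing)).
        -- intros t _. apply HP.
        -- intros t _. apply continuous_const.
        -- intros t _. apply Hk.
      * etransitivity; [apply (f_equal (minus (G := C_R_NormedModule) (scal x (P x)))),
          (scal_zero_l (V := C_R_NormedModule) (P 0)) |].
        etransitivity; [apply (minus_zero_r (G := C_R_NormedModule)) | apply scal_R_Cmult].
  - rewrite cesaro_fun_npos by lra. ring.
Qed.

(** * Approximating functions that vanish at 0 and infinity by elements of the range *)

Lemma continuous_pos_part (g : R -> R) (x : R) :
  continuous g x -> continuous (fun t => Rmax 0 (g t)) x.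
Proof.
  intros Hg. apply (continuous_ext (fun t => (g t + Rabs (g t)) * / 2)).
  { intros t. unfold Rmax, Rabs. destruct Rle_dec, Rcase_abs; lra. }
  apply (continuous_mult (K := R_AbsRing)); [| apply continuous_const].
  apply (continuous_plus (V := R_NormedModule)); [exact Hg | now apply continuous_Rabs_comp].
Qed.

(* [t * cutoff e d t = max 0 (t / (t + e) - d t)] tends to [1] on [(0,oo)] as [e, d -> 0]. *)
Definition cutoff (e d t : R) : R := Rmax 0 (/ (Rabs t + e) - d).

(** The absolute value in [cutoff] keeps the denominator at least [e] on the whole line, so the
    inverse never meets 0. *)
Lemma continuous_cutoff (e d x : R) : 0 < e -> continuous (cutoff e d) x.
Proof.
  intros He.
  apply continuous_pos_part, (continuous_minus (V := R_NormedModule));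
    [| apply continuous_const].
  apply continuous_Rinv_comp.
  - apply (continuous_plus (V := R_NormedModule));
      [apply continuous_Rabs | apply continuous_const].
  - generalize (Rabs_pos x); lra.
Qed.

Lemma cutoff_vanish (e d t : R) : 0 < e -> 0 < d -> / d <= t -> cutoff e d t = 0.
Proof.
  intros He Hd Ht. apply Rmax_left.
  assert (0 < / d) by now apply Rinv_0_lt_compat.
  rewrite Rabs_pos_eq by lra.
  assert (/ (t + e) <= d); [| lra].
  rewrite <- (Rinv_inv d). apply Rinv_le_contravar; lra.
Qed.

(** Both bounds come from 1 - t/(t + e) = e/(t + e). The bound 1 serves near 0 and infinity, where
    the approximated function is small; the other serves in between. *)
Lemma cutoff_bounds (e d t : R) : 0 < e -> 0 < d -> 0 <= t ->
  0 <= 1 - t * cutoff e d t <= Rmin 1 (e / (t + e) + d * t).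
Proof.
  intros He Hd Ht. unfold cutoff. rewrite Rabs_pos_eq by exact Ht.
  assert (E : t * / (t + e) = 1 - e / (t + e)) by (field; lra).
  assert (0 <= e / (t + e)) by (apply Rdiv_le_0_compat; lra).
  assert (0 <= d * t) by (apply Rmult_le_pos; lra).
  apply Rmax_case_strong; intros H1; unfold Rmin; destruct Rle_dec; split; nra.
Qed.

(** The approximant is x [cutoff e d x] f(x). Left of [a] and right of [b], f is below eps/2 and the
    error factor is at most 1; on the middle interval the factor is at most 2s while f is bounded by
    [M]. *)
Lemma Cl_vanishing_approx (f : Cl) (eps : R) :
  f 0 = 0 -> at_infty f = 0 -> 0 < eps ->
  exists g, range_I_minus cesaro g /\ Cl_norm (minus g f) < eps.
Proof.
  intros Hf0 Hfi Heps.
  assert (He2 : 0 < eps / 2) by lra.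
  destruct (proj1 (filterlim_C_eps f (f 0)) (Cl_continuous f 0) _ He2) as [a Ha].
  destruct (proj1 (filterlim_C_eps f _) (at_infty_correct f) _ He2) as [b0 Hb0].
  assert (Ha0 := cond_pos a).
  set (b := Rmax b0 0 + 1).
  assert (Hb : b0 < b /\ 0 < b)
    by (generalize (Rmax_l b0 0) (Rmax_r b0 0); unfold b; lra).
  set (M := Cl_norm f + 1).
  assert (HM : 0 < M) by (generalize (Cl_norm_ge_0 f); unfold M; lra).
  (* Chosen so that 2sM = eps/2. Then e = as forces e/(x + e) <= s for x >= a, and d = s/b forces dx
     <= s for x <= b. *)
  set (s := eps / (4 * M)).
  assert (Hs : 0 < s) by (apply Rdiv_lt_0_compat; lra).
  set (e := a * s). set (d := s / b).
  assert (He : 0 < e) by (apply Rmult_lt_0_compat; lra).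
  assert (Hd : 0 < d) by (apply Rdiv_lt_0_compat; lra).
  destruct (range_I_minus_cesaro_of_compact_support
              (fun t => scal (V := C_R_NormedModule) (cutoff e d t) (f t)) (/ d)) as [h Hh].
  - intros x. apply (continuous_scal (V := C_R_NormedModule));
      [now apply continuous_cutoff | apply Cl_continuous].
  (* On the negative axis f takes the value f(0), which is 0 here. *)
  - intros x Hx. rewrite (Cl_neg f x Hx), Hf0. apply (scal_zero_r (V := C_R_NormedModule)).
  - intros x Hx. rewrite cutoff_vanish by assumption.
    apply (scal_zero_l (V := C_R_NormedModule)).
  - exists (minus h (cesaro h)). split; [now exists h |].
    apply Rle_lt_trans with (eps / 2); [| lra].
    apply Cl_norm_le. intros x Hx.
    rewrite Cl_minus_val, (Hh x Hx), scal_R_Cmult.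
    replace (x * (cutoff e d x * f x) - f x)%C
      with (- ((1 - x * cutoff e d x)%R * f x))%C
      by (rewrite RtoC_minus, RtoC_mult; ring).
    rewrite Cmod_opp, Cmod_mult, Cmod_R.
    destruct (cutoff_bounds e d x He Hd Hx) as [Hc0 Hc].
    rewrite Rabs_pos_eq by exact Hc0.
    assert (Hc1 := Rle_trans _ _ _ Hc (Rmin_l _ _)).
    assert (Hc2 := Rle_trans _ _ _ Hc (Rmin_r _ _)).
    assert (Hfx := Cmod_ge_0 (f x)).
    assert (Hsmall : Cmod (f x) <= eps / 2 ->
              (1 - x * cutoff e d x) * Cmod (f x) <= eps / 2) by nra.
    destruct (Rlt_dec x a) as [Hxa | Hxa].
    { apply Hsmall, Rlt_le. replace (f x) with (f x - f 0)%C by (rewrite Hf0; ring).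
      apply Ha. change (Rabs (x - 0) < a). apply Rabs_def1; lra. }
    destruct (Rlt_dec b x) as [Hbx | Hbx].
    { apply Hsmall, Rlt_le. replace (f x) with (f x - at_infty f)%C by (rewrite Hfi; ring).
      apply Hb0. lra. }
    assert (He1 : e / (x + e) <= s).
    { apply Rmult_le_reg_r with (x + e); [lra |].
      replace (e / (x + e) * (x + e)) with e by (field; lra). unfold e at 1. nra. }
    assert (Hd1 : d * x <= s).
    { replace s with (d * b) by (unfold d; field; lra). nra. }
    apply Rle_trans with ((2 * s) * M).
    + apply Rmult_le_compat; try lra.
      generalize (Cl_norm_ge f x Hx). unfold M. lra.
    + right. unfold s. field. lra.
Qed.

(** * Failure of hypercyclicity and of mean ergodicity; conclusion *)

Lemma exists_Cl_0_1 : exists f : Cl, f 0 = 0 /\ at_infty f = 1.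
Proof.
  (* The clamp of x to [0,1], written with positive parts only so that [continuous_pos_part] applies
     twice. *)
  set (r := fun x => 1 - Rmax 0 (1 - Rmax 0 x)).
  assert (r0 : forall x, x <= 0 -> r x = 0).
  { intros x Hx. unfold r. rewrite (Rmax_left 0 x), Rmax_right; lra. }
  assert (r1 : forall x, 1 <= x -> r x = 1).
  { intros x Hx. unfold r. rewrite (Rmax_right 0 x), Rmax_left; lra. }
  assert (rcont : forall x, continuous r x).
  { intros x. apply (continuous_minus (V := R_NormedModule)); [apply continuous_const |].
    apply continuous_pos_part, (continuous_minus (V := R_NormedModule));
      [apply continuous_const |].
    apply continuous_pos_part, continuous_id. }
  set (f := fun x => scal (V := C_R_NormedModule) (r x) (RtoC 1) : C).
  assert (Hf : forall x, f x = r x) by (intros; unfold f; rewrite scal_R_Cmult; ring).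
  assert (fneg : forall x, x < 0 -> f x = f 0) by (intros; now rewrite !Hf, !r0 by lra).
  assert (flim : filterlim f (Rbar_locally p_infty) (locally (RtoC 1))).
  { apply (filterlim_ext_loc (fun _ => RtoC 1)); [| apply filterlim_const].
    exists 1. intros x Hx. now rewrite Hf, r1 by lra. }
  assert (fcont : continuous_on (fun x => 0 <= x) f).
  { apply continuous_on_of_continuous. intros x _.
    apply (continuous_scal_l (V := C_R_NormedModule)), rcont. }
  exists (mkCl f fneg fcont (ex_intro _ (RtoC 1) flim)). split.
  - simpl. now rewrite Hf, r0 by lra.
  - now apply at_infty_unique.
Qed.

Lemma cesaro_not_hypercyclic : ~ hypercyclic cesaro.
Proof.
  intros [x Hx].
  (* Any element whose value at 0 differs from that of [x] lies outside the orbit closure. *)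
  set (y := Cl_const (x 0 + 1)%C).
  assert (E : y 0 = x 0).
  { apply (closure_linear_const (X := Cl_CompleteNormedModule) (V := C_NormedModule)
             (fun f : Cl => f 0) (x 0) _ y eval_0_linear) with (2 := Hx y).
    intros z [n ->].
    exact (op_pow_invariant (X := Cl_CompleteNormedModule) cesaro (fun f : Cl => f 0) n x
             cesaro_eval_0). }
  change ((x 0 + 1)%C = x 0) in E.
  apply C1_nz. replace (RtoC 1) with (x 0 + 1 - x 0)%C by ring. rewrite E. ring.
Qed.

Lemma cesaro_not_mean_ergodic : ~ mean_ergodic cesaro.
Proof.
  intros [P HP]. destruct exists_Cl_0_1 as [f [Hf0 Hf1]].
  set (g := P f : Cl).
  assert (Hfix : cesaro g = g).
  { apply (limit_cesaro_mean_fixed cesaro (Cl_norm f) f g) with (2 := HP f).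
    intros n. apply cesaro_pow_norm_le. }
  assert (H0 : g 0 = 0).
  { rewrite <- Hf0.
    exact (limit_cesaro_mean_invariant (X := Cl_CompleteNormedModule) (V := C_NormedModule)
             cesaro (fun h : Cl => h 0) f g eval_0_linear cesaro_eval_0 (HP f)). }
  assert (H1 : at_infty g = 1).
  { rewrite <- Hf1.
    exact (limit_cesaro_mean_invariant (X := Cl_CompleteNormedModule) (V := C_NormedModule)
             cesaro at_infty f g at_infty_linear at_infty_cesaro (HP f)). }
  (* [cesaro_fixed_constant] only reaches positive points, so the value at 0 is recovered as a right
     limit; [E1] treats infinity likewise, and together they force 1 = 0. *)
  assert (E0 : g 1 = g 0).
  { apply (filterlim_locally_unique (V := C_NormedModule) (F := at_right 0) g).
    - apply (filterlim_ext_loc (fun _ => g 1)); [| apply filterlim_const].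
      exists (mkposreal 1 Rlt_0_1). intros x Hx Hx0.
      change (Rabs (x - 0) < 1) in Hx. apply Rabs_def2 in Hx.
      symmetry. apply cesaro_fixed_constant; [exact Hfix | exact Hx0 | lra].
    - apply filterlim_filter_le_1 with (2 := Cl_continuous g 0). apply filter_le_within. }
  assert (E1 : at_infty g = g 1).
  { apply at_infty_unique.
    apply (filterlim_ext_loc (fun _ => g 1)); [| apply filterlim_const].
    exists 1. intros x Hx. apply cesaro_fixed_constant; [exact Hfix | lra | lra]. }
  apply C1_nz. now rewrite <- H1, E1, E0.
Qed.

Theorem theorem2p5 :
  power_bounded cesaro /\
  ~ hypercyclic cesaro /\
  ~ mean_ergodic cesaro /\
  (forall f : Cl,
     closure (range_I_minus cesaro) f <->
     (f 0%R = RtoC 0 /\ at_infty f = RtoC 0)).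
Proof.
  split; [| split; [| split]].
  - apply power_bounded_of_contraction, cesaro_contraction.
  - exact cesaro_not_hypercyclic.
  - exact cesaro_not_mean_ergodic.
  - intros f. split.
    + intros Hf. split.
      * apply (closure_range_I_minus_invariant (X := Cl_CompleteNormedModule)
                 (V := C_NormedModule) cesaro (fun h : Cl => h 0) f);
          [exact eval_0_linear | exact cesaro_eval_0 | exact Hf].
      * apply (closure_range_I_minus_invariant (X := Cl_CompleteNormedModule)
                 (V := C_NormedModule) cesaro at_infty f);
          [exact at_infty_linear | exact at_infty_cesaro | exact Hf].
    + intros [H0 H1]. apply closure_Cl. intros eps Heps.
      now apply Cl_vanishing_approx.
Qed.
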